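(* Let $\Pi$ be an EFC process with characteristics $(c_k,\nu_{Coag},c_e,\nu_{Disl})$ that fragmentates quickly, i.e. such that $c_e>0$ or $\nu_{Disl}(\mathcal S^\downarrow)=\infty$. Then, almost surely, the set $G=\{t\ge0:\#\Pi(t)=\infty\}$ is everywhere dense in $[0,\infty)$.
   Context: Partitions. $\mathbb N=\{1,2,\dots\}$, $[n]=\{1,\dots,n\}$. $\mathcal P$ (resp. $\mathcal P_n$) is the set of partitions of $\mathbb N$ (resp. $[n]$); $\pi=(B_1,B_2,\dots)$ lists the blocks in increasing order of least element (followed by empty blocks if there are finitely many). $i\overset{\pi}{\sim}j$ means $i,j$ are in the same block of $\pi$; $\pi_{|[n]}$ is the restriction to $[n]$; $\#\pi$ is the number of non-empty blocks; $\mathbf 0$ is the partition into singletons, $\mathbf 1$ the one-block partition, $\mathbf 0_n,\mathbf 1_n$ their restrictions to $[n]$. $\mathcal P$ carries the compact metric $d(\pi,\pi')=1/\max\{n:\pi_{|[n]}=\pi'_{|[n]}\}$ ($0$ if $\pi=\pi'$). For a permutation $\sigma$, $\sigma(\pi)$ is defined by $i\overset{\sigma(\pi)}{\sim}j\iff\sigma(i)\overset{\pi}{\sim}\sigma(j)$. A random partition or $\mathcal P$-valued process is exchangeable if its law is invariant under every permutation $\sigma$ of $\mathbb N$ with $\sigma(n)=n$ for all large $n$. Operators. For $\pi=(B_i)$, $\pi'=(B'_j)$: $Coag(\pi,\pi')$ has blocks $\bigcup_{i\in B'_j}B_i$; $Frag(\pi,\pi',k)$ keeps every $B_i$, $i\ne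 k$, and replaces $B_k$ by the non-empty sets $B_k\cap B'_j$. For $\pi\in\mathcal P_n$, $Coag(\pi,\pi')$ is defined likewise for $\pi'\in\mathcal P_{\#\pi}$, and for $\pi'\in\mathcal P_{|B_k|}$, $Frag(\pi,\pi',k)$ is defined by identifying $B_k$ with $[|B_k|]$ via the increasing bijection. EFC processes. An EFC (exchangeable fragmentation-coalescence) process is an exchangeable $\mathcal P$-valued Markov process $(\Pi(t))_{t\ge0}$ whose restrictions $\Pi_{|[n]}$ are càdlàg finite-state Markov chains whose transition rates $q_n(\pi,\pi')$ are non-zero only if $\pi'=Coag(\pi,\pi'')$ for some $\pi''$ or $\pi'=Frag(\pi,\pi'',k)$ for some $\pi'',k$. Characteristics. $\mathcal S^\downarrow=\{x=(x_1\ge x_2\ge\dots\ge0):\sum_i x_i\le1\}$. For $x\in\mathcal S^\downarrow$, $\mu_x$ is the law of the partition with $i\sim j\iff X_i=X_j$, where the $X_i$ are independent, $P(X_i=k)=x_k$ ($k\ge1$), $P(X_i=-i)=1-\sum_jx_j$; $\mu_\nu=\int\mu_x\,\nu(dx)$. $\mathbf e=\sum_n\delta_{\epsilon_n}$, $\epsilon_n$ having blocks $\{n\}$, $\mathbb N\setminus\{n\}$; $\kappa=\sum_{i<j}\delta_{\epsilon_{i,j}}$, $\epsilon_{i,j}$ having $\{i,j\}$ as only non-singleton block. Characteristics are $c_k,c_e\ge0$ and measures $\nu_{Coag},\nu_{Disl}$ on $\mathcal S^\downarrow$ with $\nu_{Coag}(\{(0,0,\dots)\})=0$, $\int\sum_ix_i^2\,\nu_{Coag}(dx)<\infty$,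 $\nu_{Disl}(\{(1,0,\dots)\})=0$, $\int(1-\sum_ix_i^2)\,\nu_{Disl}(dx)<\infty$. With $C=c_k\kappa+\mu_{\nu_{Coag}}$ and $F=c_e\mathbf e+\mu_{\nu_{Disl}}$, an EFC process has these characteristics if, for $\pi\in\mathcal P_n$ with $m$ blocks, $q_n(\pi,Coag(\pi,\pi'))=C(\{\pi'':\pi''_{|[m]}=\pi'\})$ for $\pi'\in\mathcal P_m\setminus\{\mathbf 0_m\}$, $q_n(\pi,Frag(\pi,\pi',k))=F(\{\pi'':\pi''_{|[|B_k|]}=\pi'\})$ for $\pi'\in\mathcal P_{|B_k|}\setminus\{\mathbf 1_{|B_k|}\}$, and all other rates vanish. Every EFC process has unique characteristics. Poissonian construction. Such a $\Pi$ may be taken constructed from independent Poisson point processes $P_C=((t,\pi^{(C)}(t)))$ with intensity $dt\otimes C$ and $P_F=((t,\pi^{(F)}(t),k(t)))$ with intensity $dt\otimes F\otimes\#$ ($\#$ counting measure on $\mathbb N$): each restriction $\Pi_{|[n]}$ changes only at atom times, becoming $Coag(\Pi_{|[n]}(t-),\pi^{(C)}(t))$, resp. $Frag(\Pi_{|[n]}(t-),\pi^{(F)}(t),k(t))$. *)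

(* Defs.v *)
(* The element i of {1, 2, ...} is coded by the
   natural number i - 1; so [n] is 'I_n, and the k-th block has index k - 1. *)
From HB Require Import structures.
From mathcomp Require Import all_boot all_order all_algebra.
Set Implicit Arguments.
Unset Strict Implicit.
Unset Printing Implicit Defensive.

Record partI (n : nat) := PartI {
  blocks_of :> {set {set 'I_n}};
  partIP : partition blocks_of [set: 'I_n] }.

HB.instance Definition _ n := [isSub for @blocks_of n].
HB.instance Definition _ n := [Finite of partI n by <:].

Definition block_minima n (P : partI n) : {set 'I_n} :=
  [set i | [forall j in pblock P i, i <= j]].

Definition ordered_blocks n (P : partI n) : seq {set 'I_n} :=
  [seq pblock P i | i <- enum (block_minima P)].

(* [enum] lists the minima increasingly; the value is empty for k >= #|P| *)
Definition block n (P : partI n) (k : nat) : {set 'I_n} :=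
  nth set0 (ordered_blocks P) k.
Lemma perm_ordered_blocks n (P : partI n) : perm_eq (ordered_blocks P) (enum P).
Proof.
have Ppart := partIP P; have /and3P[/eqP covP tiP _] := Ppart.
have inP i : i \in pblock P i by rewrite mem_pblock covP inE.
apply: uniq_perm; rewrite ?enum_uniq //.
  rewrite map_inj_in_uniq ?enum_uniq // => i j.
  rewrite !mem_enum !inE => /forall_inP mi /forall_inP mj eij.
  apply/val_inj/eqP; rewrite eqn_leq mi ?mj // ?eij ?inP //.
  by rewrite -eij inP.
move=> B; rewrite mem_enum; apply/mapP/idP => [[i _ ->]|BP].
  by rewrite pblock_mem // covP inE.
have /set0Pn[x xB] := partition_neq0 Ppart BP.
case: (arg_minnP (fun i : 'I_n => i : nat) xB) => i iB mini.
exists i; last by rewrite (def_pblock tiP BP iB).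
rewrite mem_enum inE (def_pblock tiP BP iB); exact/forall_inP.
Qed.

Lemma size_ordered_blocks n (P : partI n) : size (ordered_blocks P) = #|P|.
Proof. by rewrite (perm_size (perm_ordered_blocks P)) -cardE. Qed.

Lemma block_mem n (P : partI n) k : k < #|P| -> block P k \in P.
Proof.
by rewrite -size_ordered_blocks => /(mem_nth set0); rewrite (perm_mem (perm_ordered_blocks P)) mem_enum.
Qed.

Lemma block_inj n (P : partI n) k l : k < #|P| -> l < #|P| ->
  block P k = block P l -> k = l.
Proof.
rewrite -size_ordered_blocks => kP lP /eqP; rewrite nth_uniq //; first by move/eqP.
by rewrite (perm_uniq (perm_ordered_blocks P)) enum_uniq.
Qed.

Lemma block_disjoint n (P : partI n) k l x : k < #|P| -> l < #|P| ->
  x \in block P k -> x \in block P l -> k = l.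
Proof.
move=> kP lP xk xl; apply: (block_inj kP lP).
have tiP := partition_trivIset (partIP P).
by rewrite -(def_pblock tiP (block_mem kP) xk) (def_pblock tiP (block_mem lP) xl).
Qed.

Lemma block_cover n (P : partI n) (x : 'I_n) :
  exists2 k : 'I_#|P|, x \in block P k & block P k = pblock P x.
Proof.
have /and3P[/eqP covP tiP _] := partIP P.
have : pblock P x \in ordered_blocks P.
  by rewrite (perm_mem (perm_ordered_blocks P)) mem_enum pblock_mem // covP inE.
move=> /(nthP set0)[k]; rewrite size_ordered_blocks => kP e.
by exists (Ordinal kP); rewrite /block /= e // mem_pblock covP inE.
Qed.

Definition coag_blocks n (P : partI n) (P' : partI #|P|) : {set {set 'I_n}} :=
  [set \bigcup_(i in B' : {set 'I_#|P|}) block P i | B' in P'].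

Lemma coag_partition n (P : partI n) (P' : partI #|P|) :
  partition (coag_blocks P') [set: 'I_n].
Proof.
have /and3P[/eqP covP' tiP' s0P'] := partIP P'.
apply/and3P; split.
- apply/eqP/setP => x; rewrite inE; apply/bigcupP.
  have [k xk _] := block_cover P x.
  exists (\bigcup_(i in pblock P' k) block P i).
    by apply: imset_f; rewrite pblock_mem // covP' inE.
  by apply/bigcupP; exists k => //; rewrite mem_pblock covP' inE.
- apply/trivIsetP => _ _ /imsetP[B BP' ->] /imsetP[D DP' ->] neq.
  rewrite -setI_eq0; apply/eqP/setP => x; rewrite !inE; apply/negP.
  move=> /andP[/bigcupP[i iB xi] /bigcupP[j jD xj]].
  have ij : i = j by apply/val_inj/(block_disjoint _ _ xi xj); exact: ltn_ord.
  move: neq; rewrite -(def_pblock tiP' BP' iB) -(def_pblock tiP' DP' jD) ij.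
  by rewrite eqxx.
- apply/negP => /imsetP[B BP' /esym/eqP]; apply/negP/set0Pn.
  have /set0Pn[i iB] := partition_neq0 (partIP P') BP'.
  have /set0Pn[x xi] := partition_neq0 (partIP P) (block_mem (ltn_ord i)).
  by exists x; apply/bigcupP; exists i.
Qed.

Definition coag n (P : partI n) (P' : partI #|P|) : partI n :=
  PartI (coag_partition P').

Definition frag_blocks n (P : partI n) (k : 'I_#|P|)
    (P' : partI #|block P k|) : {set {set 'I_n}} :=
  P :\ block P k :|:
  [set enum_val @: (B' : {set 'I_#|block P k|}) | B' in P'].

Lemma frag_partition n (P : partI n) (k : 'I_#|P|)
    (P' : partI #|block P k|) : partition (frag_blocks P') [set: 'I_n].
Proof.
have /and3P[/eqP covP tiP s0P] := partIP P.
have /and3P[/eqP covP' tiP' s0P'] := partIP P'.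
have kP := block_mem (ltn_ord k).
have subB (B : {set 'I_#|block P k|}) : enum_val @: B \subset block P k.
  by apply/subsetP => _ /imsetP[j _ ->]; exact: enum_valP.
apply/and3P; split.
- apply/eqP/setP => x; rewrite inE; apply/bigcupP.
  have [xk|xk] := boolP (x \in block P k).
    exists (enum_val @: pblock P' (enum_rank_in xk x)).
      by rewrite inE; apply/orP; right; apply: imset_f; rewrite pblock_mem // covP' inE.
    apply/imsetP; exists (enum_rank_in xk x); last by rewrite enum_rankK_in.
    by rewrite mem_pblock covP' inE.
  exists (pblock P x); last by rewrite mem_pblock covP inE.
  rewrite !inE pblock_mem ?covP ?inE // andbT; apply/orP; left.
  by apply: contraNneq xk => <-; rewrite mem_pblock covP inE.
- apply/trivIsetP => A B; rewrite !inE.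
  have disj (C : {set 'I_n}) (D : {set 'I_#|block P k|}) :
      C != block P k -> C \in P ->
      [disjoint C & enum_val @: D].
    move=> neq CP; apply: disjointWr (subB D) _.
    by move/trivIsetP: tiP; apply.
  move=> /orP[/andP[Ak AP]|/imsetP[A' A'P ->]] /orP[/andP[Bk BP]|/imsetP[B' B'P ->]] neq.
  + by move/trivIsetP: tiP; apply.
  + exact: disj.
  + by rewrite disjoint_sym; exact: disj.
  + rewrite imset_disjoint; last exact: enum_val_inj.
    by move/trivIsetP: tiP'; apply => //; apply: contraNneq neq => ->.
- rewrite !inE negb_or (negbTE s0P) andbF /=.
  apply/negP => /imsetP[B BP' /esym/eqP]; apply/negP/set0Pn.
  have /set0Pn[i iB] := partition_neq0 (partIP P') BP'.
  by exists (enum_val i); apply: imset_f.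
Qed.

Definition frag n (P : partI n) (k : 'I_#|P|)
    (P' : partI #|block P k|) : partI n :=
  PartI (frag_partition P').

(* Not loaded above: classical_sets shadows the finset notations. *)
From mathcomp Require Import all_classical all_reals all_analysis.
Import Order.TTheory GRing.Theory Num.Theory.
Import numFieldNormedType.Exports.
Local Open Scope classical_set_scope.
Local Open Scope ring_scope.

Record partN := PartN {
  same_block :> rel nat;
  partN_equiv : equivalence_rel same_block }.

Lemma labels_equiv (T : eqType) (X : nat -> T) :
  equivalence_rel (fun i j => X i == X j).
Proof. by move=> i j k; split=> // /eqP ->. Qed.

Definition part_of_labels (T : eqType) (X : nat -> T) : partN :=
  PartN (labels_equiv X).

HB.instance Definition _ := gen_eqMixin partN.
HB.instance Definition _ := gen_choiceMixin partN.
HB.instance Definition _ := isPointed.Build partN (part_of_labels id).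

Definition blocksN (pi : partN) : set (set nat) :=
  range (fun i => [set j | pi i j]).

Lemma restr_equiv n (pi : partN) :
  {in [set: 'I_n]%SET & &, equivalence_rel (fun i j : 'I_n => pi i j)}.
Proof. by move=> i j k _ _ _; exact: partN_equiv. Qed.

Definition restr n (pi : partN) : partI n :=
  PartI (equivalence_partitionP (@restr_equiv n pi)).

(* The closed balls of the metric d; being countably many, they generate its
   Borel sigma-algebra. *)
Definition cylinders : set (set partN) :=
  [set A | exists n (P : partI n), A = [set pi | restr n pi = P]].

HB.instance Definition _ := @isMeasurable.Build (sigma_display cylinders)
  partN <<s cylinders >> (@sigma_algebra0 _ setT cylinders)
  (@sigma_algebraC _ cylinders) (@sigma_algebra_bigcup _ setT cylinders).

Lemma permute_equiv (sigma : nat -> nat) (pi : partN) :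
  equivalence_rel (fun i j => pi (sigma i) (sigma j)).
Proof. by move=> i j k; exact: partN_equiv. Qed.

Definition permute (sigma : nat -> nat) (pi : partN) : partN :=
  PartN (permute_equiv sigma pi).

Record Sdown (R : realType) := SDown {
  mass :> nat -> R;
  mass_ge0 : forall i, 0 <= mass i;
  mass_noninc : forall i, mass i.+1 <= mass i;
  mass_sum : (\sum_(0 <= i <oo) (mass i)%:E <= 1)%E }.

Lemma mass0_sum (R : realType) : (\sum_(0 <= i <oo) (0 : R)%:E <= 1)%E.
Proof. by rewrite eseries0 ?lee01. Qed.

HB.instance Definition _ (R : realType) := gen_eqMixin (Sdown R).
HB.instance Definition _ (R : realType) := gen_choiceMixin (Sdown R).
HB.instance Definition _ (R : realType) := isPointed.Build (Sdown R)
  (@SDown R (fun=> 0) (fun=> lexx 0) (fun=> lexx 0) (@mass0_sum R)).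

Definition coordinate_sets (R : realType) : set (set (Sdown R)) :=
  \bigcup_i preimage_set_system setT (fun x : Sdown R => x i) measurable.

HB.instance Definition _ (R : realType) :=
  @isMeasurable.Build (sigma_display (@coordinate_sets R))
  (Sdown R) <<s @coordinate_sets R >>
  (@sigma_algebra0 _ setT (@coordinate_sets R))
  (@sigma_algebraC _ (@coordinate_sets R))
  (@sigma_algebra_bigcup _ setT (@coordinate_sets R)).

Section characteristics.
Context (R : realType).
Local Open Scope ereal_scope.

(* m = mu_x.  The law of (X_i) is determined by x, hence so is m, and such an m
   exists for every x. *)
Definition is_paintbox_law (x : Sdown R) (m : probability partN R) : Prop :=
  exists (d : measure_display) (T : measurableType d) (P : probability T R)
    (X : nat -> T -> int),
  [/\ forall i (A : set int), measurable (X i @^-1` A),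
      forall n (A : nat -> set int),
        P [set w | forall i, (i < n)%N -> A i (X i w)] =
        \prod_(i < n) P (X i @^-1` A i),
      forall i k, P [set w | X i w = k.+1%:Z] = (x k)%:E,
      forall i, P [set w | X i w = (- i.+1%:Z)%R] =
        1 - \sum_(0 <= k <oo) (x k)%:E
    & forall A, measurable A -> m A = P [set w | A (part_of_labels (X^~ w))]].

Definition epsilon1 (n : nat) : partN := part_of_labels (fun i => i == n).

Definition epsilon2 (i j : nat) : partN :=
  part_of_labels (fun k => if k == j then i else k).

Definition kappa (A : set partN) : \bar R :=
  \esum_(p in [set p : nat * nat | (p.1 < p.2)%N]) \d_(epsilon2 p.1 p.2) A.

Definition erosion (A : set partN) : \bar R :=
  \sum_(0 <= n <oo) \d_(epsilon1 n) A.

Definition is_characteristics (ck : R) (nuC : {measure set (Sdown R) -> \bar R})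
    (ce : R) (nuD : {measure set (Sdown R) -> \bar R}) : Prop :=
  [/\ (0 <= ck)%R /\ (0 <= ce)%R,
      nuC [set x | forall i : nat, x i = 0%R] = 0,
      \int[nuC]_x (\sum_(0 <= i <oo) (x i ^+ 2)%:E) < +oo,
      nuD [set x | forall i : nat, x i = (i == 0%N)%:R] = 0
    & \int[nuD]_x (1 - \sum_(0 <= i <oo) (x i ^+ 2)%:E) < +oo].

Definition coag_measure (mu : Sdown R -> probability partN R) (ck : R)
    (nuC : {measure set (Sdown R) -> \bar R}) (A : set partN) : \bar R :=
  ck%:E * kappa A + \int[nuC]_x mu x A.

Definition frag_measure (mu : Sdown R -> probability partN R) (ce : R)
    (nuD : {measure set (Sdown R) -> \bar R}) (A : set partN) : \bar R :=
  ce%:E * erosion A + \int[nuD]_x mu x A.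

Definition has_characteristics (q : forall n, partI n -> partI n -> R)
    (ck : R) (nuC : {measure set (Sdown R) -> \bar R})
    (ce : R) (nuD : {measure set (Sdown R) -> \bar R}) : Prop :=
  exists mu : Sdown R -> probability partN R,
    (forall x, is_paintbox_law x (mu x)) /\
    forall n (P : partI n),
    [/\ forall P' : partI #|P|,
          blocks_of P' <> [set [set i] | i : 'I_#|P|]%SET ->
          (q n P (coag P'))%:E =
          coag_measure mu ck nuC [set pi | restr #|P| pi = P'],
        forall (k : 'I_#|P|) (P' : partI #|block P k|),
          blocks_of P' <> [set [set: 'I_#|block P k|]]%SET ->
          (q n P (frag P'))%:E =
          frag_measure mu ce nuD [set pi | restr #|block P k| pi = P']
      & forall Q : partI n, Q <> P ->
          (forall P' : partI #|P|, Q <> coag P') ->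
          (forall (k : 'I_#|P|) (P' : partI #|block P k|), Q <> frag P') ->
          q n P Q = 0%R].

Definition fragmentates_quickly (ce : R)
    (nuD : {measure set (Sdown R) -> \bar R}) : Prop :=
  (0 < ce)%R \/ nuD [set: Sdown R] = +oo.

End characteristics.

Section processes.
Context (R : realType) (d : measure_display) (T : measurableType d).
Variable P : probability T R.

(* Processes are indexed by R; only their values at times t >= 0 matter. *)

Definition past (S : Type) (X : R -> T -> S) (M : set (set S)) (s : R) :
    set (set T) :=
  <<s \bigcup_(u in [set u | 0 <= u <= s]) preimage_set_system setT (X u) M >>.

(* K is a version of the conditional law of X t given the past up to s; it
   depends on that past through X s only. *)
Definition markov_process d' (S : measurableType d') (X : R -> T -> S) : Prop :=
  forall s t, 0 <= s <= t ->
    exists K : R.-pker S ~> S, forall A B, past X measurable s A ->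
      measurable B ->
      P (A `&` X t @^-1` B) = (\int[P]_(w in A) K (X s w) B)%E.

(* p is the transition function; q gives the off-diagonal rates, the diagonal
   entries of q being irrelevant. *)
Definition markov_chain (S : finType) (X : R -> T -> S) (q : S -> S -> R) :
    Prop :=
  exists p : R -> S -> S -> R,
  [/\ forall t x, 0 <= t ->
        (forall y, 0 <= p t x y) /\ \sum_y p t x y = 1,
      forall x y, p 0 x y = (x == y)%:R,
      forall s t x z, 0 <= s -> 0 <= t ->
        p (s + t) x z = \sum_y p s x y * p t y z,
      forall x y, x != y -> p h x y / h @[h --> 0^'+] --> q x y
    & forall s t x y A, 0 <= s <= t -> past X setT s A ->
        P (A `&` [set w | X s w = x] `&` [set w | X t w = y]) =
        (P (A `&` [set w | X s w = x]) * (p (t - s) x y)%:E)%E].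

(* for the discrete topology on S *)
Definition cadlag (S : Type) (f : R -> S) : Prop :=
  (forall t, 0 <= t -> \forall s \near t^'+, f s = f t) /\
  (forall t, 0 < t -> exists x, \forall s \near t^'-, f s = x).

Definition path_events : set (set (R -> partN)) :=
  <<s \bigcup_(t in [set t | 0 <= t])
        preimage_set_system setT (fun f : R -> partN => f t) measurable >>.

Definition exchangeable (Pi : R -> T -> partN) : Prop :=
  forall sigma : nat -> nat, bijective sigma ->
    (exists N, forall n, (N <= n)%N -> sigma n = n) ->
    forall E, path_events E ->
      P [set w | E (fun t => permute sigma (Pi t w))] = P [set w | E (Pi^~ w)].

Record EFC_process (Pi : R -> T -> partN)
    (q : forall n, partI n -> partI n -> R) : Prop := {
  EFC_measurable : forall t, 0 <= t -> measurable_fun setT (Pi t);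
  EFC_exchangeable : exchangeable Pi;
  EFC_markov : markov_process Pi;
  EFC_cadlag : forall n,
    {ae P, forall w, cadlag (fun t => restr n (Pi t w))};
  EFC_restr : forall n, markov_chain (fun t w => restr n (Pi t w)) (q n);
  EFC_moves : forall n (pi pi' : partI n), pi' <> pi -> q n pi pi' <> 0 ->
    (exists P' : partI #|pi|, pi' = coag P') \/
    (exists (k : 'I_#|pi|) (P' : partI #|block pi k|), pi' = frag P') }.

End processes.

Definition infinite_times (R : realType) (path : R -> partN) : set R :=
  [set t | 0 <= t /\ infinite_set (blocksN (path t))].

(* Main.v *)
Require Import Defs.
From mathcomp Require Import all_boot all_order all_algebra.
Set Implicit Arguments.
Unset Strict Implicit.
Unset Printing Implicit Defensive.

(** Fix k and an interval [a, b].  While the restriction of Pi to [n] has at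
    most k blocks, a coalescence must act on at most k blocks, hence occurs at
    a rate bounded independently of n ([down_rate_le]).  On the other hand one
    of the blocks has at least n / k elements, and such a block is dislocated
    at a rate which tends to infinity with n, because fragmentation is quick
    ([frag_rate_unbounded], [up_rate_ge]).  So a chain with at most k blocks is
    pushed upwards very strongly: the function g = (k + 1 - number of blocks)_+
    is positive exactly on the states with at most k blocks, and there its
    image under the generator is below - theta g, with theta as large as one
    wishes when n is large ([block_count_drift]).

    A function with such a drift decays along the chain killed when it leaves
    these states.  Reading the chain on a fine grid of [a, b] turns this into
    the bound (k + 1) / (1 + theta (b - a)) for the probability that Pi
    restricted to [n] keeps at most k blocks during all of [a, b]
    ([prob_stay_le]).  As theta is arbitrary, almost surely the number of
    blocks of Pi exceeds k somewhere in [a, b] ([few_blocks_negligible]); this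
    holds simultaneously for all k and all rational a < b.

    Having more than k blocks is witnessed by some restriction, whose path is
    right-continuous, so it persists on a small interval to the right.  Hence
    for every k the times with more than k blocks contain a dense open set, and
    Baire's theorem gives the density of the times with infinitely many blocks
    ([infinite_times_dense]).

    The growth of the dislocation rates rests on two estimates.  Erosion alone
    splits off each of the s elements of a block at rate ce.  For a paintbox
    with largest mass x_0, all of s + 1 elements stay together with probability
    at most x_0 ^ s ([paintbox_one_block]); if nuD is infinite, then so is, in
    the limit, the mass it gives to the x with x_0 <= 1 - 1 / j, and each of
    these x eventually splits the block with probability at least 1/2
    ([disl_rate_unbounded]). *)

(** * Coalescence and fragmentation of finite partitions *)

Lemma coag_singletons n (P : partI n) (P' : partI #|P|) :
  blocks_of P' = [set [set i] | i : 'I_#|P|] -> coag P' = P.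
Proof.
move=> P'1; apply: val_inj; rewrite /= /coag_blocks P'1.
apply/setP => B; apply/imsetP/idP => [[_ /imsetP[i _ ->] ->]|BP].
  by rewrite big_set1 block_mem.
have : B \in ordered_blocks P by rewrite (perm_mem (perm_ordered_blocks P)) mem_enum.
move=> /(nthP set0)[k]; rewrite size_ordered_blocks => kP e.
exists [set Ordinal kP]; first by apply: imset_f.
by rewrite big_set1.
Qed.

Lemma frag_disjoint n (P : partI n) (k : 'I_#|P|) (D : {set 'I_#|block P k|}) :
  D != set0 -> enum_val @: D \notin P :\ block P k.
Proof.
move=> /set0Pn[i iD]; rewrite !inE; apply/andP => -[/eqP neq DP]; apply: neq.
have /trivIsetP tiP := partition_trivIset (partIP P).
apply/eqP/negPn/negP => neq.
have /pred0P/(_ (enum_val i)) /= := tiP _ _ DP (block_mem (ltn_ord k)) neq.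
by rewrite imset_f // enum_valP.
Qed.

Lemma partI_neq0 n (P : partI n) B : B \in P -> B != set0.
Proof. exact: partition_neq0 (partIP P). Qed.

Lemma card_frag n (P : partI n) (k : 'I_#|P|) (P' : partI #|block P k|) :
  #|frag P'| = #|P|.-1 + #|P'|.
Proof.
rewrite [LHS]cardsU disjoint_setI0 ?cards0 ?subn0; last first.
  rewrite disjoint_sym disjoint_subset; apply/subsetP => _ /imsetP[D DP' ->].
  by rewrite inE frag_disjoint // (partI_neq0 DP').
rewrite card_imset; last exact/imset_inj/enum_val_inj.
congr (_ + _); have := cardsD1 (block P k) P; rewrite block_mem // add1n.
by move/(congr1 predn) => /= <-.
Qed.

(** The blocks of the result that are not old blocks other than the k-th are
    the images of the blocks of P', from which P' is read off. *)
Lemma frag_inj n (P : partI n) (k : 'I_#|P|) :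
  injective (@frag n P k).
Proof.
move=> P1 P2 /(congr1 (@blocks_of n)) /= e; apply: val_inj => /=.
have img (Q : partI #|block P k|) :
    [set enum_val @: (B : {set 'I_#|block P k|}) | B in Q] =
    frag_blocks Q :\: (P :\ block P k).
  rewrite /frag_blocks setDUl setDv set0U; apply/esym/setDidPl.
  rewrite disjoint_subset; apply/subsetP => _ /imsetP[D DQ ->].
  by rewrite inE frag_disjoint // (partI_neq0 DQ).
apply: (imset_inj (imset_inj (@enum_val_inj _ (block P k)))).
by rewrite (img P1) (img P2) e.
Qed.

Lemma card_partI_gt0 n (P : partI n) : (0 < #|P|) = (0 < n).
Proof.
have := card_partition (partIP P); rewrite cardsT card_ord => nE.
case: (posnP n) => [n0|n_gt0].
  apply/negbTE; rewrite -eqn0Ngt cards_eq0; apply/eqP/setP => B.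
  rewrite inE; apply/negP => BP; have /set0Pn[i _] := partI_neq0 BP.
  by have := leq_ltn_trans (leq0n i) (ltn_ord i); rewrite n0.
rewrite lt0n; apply/eqP => /eqP; rewrite cards_eq0 => /eqP P0.
by move: n_gt0; rewrite nE P0 big_set0.
Qed.

Lemma card_partI_gt1 n (P : partI n) :
  0 < n -> blocks_of P <> [set [set: 'I_n]] -> 1 < #|P|.
Proof.
rewrite -(card_partI_gt0 P) => P0 Pn1; rewrite ltn_neqAle P0 andbT.
apply/negP => /eqP/esym/eqP/cards1P[B PB]; apply: Pn1; rewrite PB.
have /and3P[/eqP cP _ _] := partIP P.
by move: cP; rewrite PB /cover big_set1 => ->.
Qed.

(** Pigeonhole: if all blocks had at most s elements, n would be at most s
    times the number of blocks. *)
Lemma large_block n s (P : partI n) : s * #|P| < n ->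
  exists k : 'I_#|P|, s < #|block P k|.
Proof.
move=> sn; apply/existsP; apply: contraLR sn => /existsPn small.
rewrite -leqNgt -{1}(card_ord n) -cardsT (card_partition (partIP P)).
rewrite mulnC -sum_nat_const leq_sum // => B BP.
have : B \in ordered_blocks P by rewrite (perm_mem (perm_ordered_blocks P)) mem_enum.
move=> /(nthP set0)[k]; rewrite size_ordered_blocks => kP e.
by have := small (Ordinal kP); rewrite -leqNgt /block /= e.
Qed.

Lemma card_block_gt0 n (P : partI n) (k : 'I_#|P|) : 0 < #|block P k|.
Proof. by rewrite card_gt0; apply: partI_neq0 (block_mem (ltn_ord k)). Qed.

Lemma leq_card_frag n (P : partI n) (k : 'I_#|P|) (P' : partI #|block P k|) :
  #|P| <= #|frag P'|.
Proof.
rewrite card_frag; apply: leq_trans (leqSpred _) _.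
by rewrite -addn1 leq_add2l card_partI_gt0 card_block_gt0.
Qed.

Lemma ltn_card_frag n (P : partI n) (k : 'I_#|P|) (P' : partI #|block P k|) :
  blocks_of P' <> [set [set: 'I_#|block P k|]] -> #|P| < #|frag P'|.
Proof.
move/(card_partI_gt1 (card_block_gt0 k)) => P'_gt1.
rewrite card_frag; apply: leq_ltn_trans (leqSpred _) _.
by rewrite -addn1 ltn_add2l.
Qed.

From mathcomp Require Import all_classical all_reals all_analysis.
From mathcomp Require Import measurable_realfun.
Import Order.TTheory GRing.Theory Num.Theory.
Import numFieldNormedType.Exports.
Local Open Scope classical_set_scope.
Local Open Scope ring_scope.

(** * Restrictions of a partition of the integers *)

Lemma eq_restr n (pi pi' : partN) :
  (forall i j : 'I_n, pi i j = pi' i j) -> restr n pi = restr n pi'.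
Proof.
move=> e; apply: val_inj => /=; rewrite /equivalence_partition.
by apply: eq_imset => x; apply/setP => y; rewrite !inE e.
Qed.

Lemma partN_refl (pi : partN) i : pi i i.
Proof. by have [] := partN_equiv pi i i i. Qed.

Lemma restr_one_block n (pi : partN) (i j : 'I_n) :
  blocks_of (restr n pi) = [set [set: 'I_n]]%SET -> pi i j.
Proof.
move=> /= e; have : [set y in [set: 'I_n] | pi i y]%SET \in
    equivalence_partition (fun i j : 'I_n => pi i j) [set: 'I_n]%SET.
  exact: imset_f.
by rewrite e inE => /eqP/setP/(_ j); rewrite !inE /=.
Qed.

(** Each block of a restriction extends to a block of [pi], injectively; so
    finitely many blocks would bound the block count of all restrictions. *)
Lemma infinite_blocksN (pi : partN) :
  (forall k, exists n, (k < #|restr n pi|)%N) -> infinite_set (blocksN pi).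
Proof.
move=> unb /finite_seqP[A blocksA].
have [n] := unb (size A); apply/negP; rewrite -leqNgt cardE.
pose f (B : {set 'I_n}) := [set j | exists2 i : 'I_n, i \in B & pi i j].
rewrite -(size_map f) uniq_leq_size //.
  rewrite map_inj_in_uniq ?enum_uniq // => B D.
  rewrite !mem_enum => /imsetP[x _ ->] /imsetP[y _ ->] /seteqP[+ _].
  move=> /(_ x) [|z]; first by exists x; [rewrite !inE partN_refl|exact: partN_refl].
  rewrite !inE /= => yz zx; apply/setP => t; rewrite !inE /=.
  have [_ /(_ yz) ->] := partN_equiv pi y z t.
  by have [_ /(_ zx) ->] := partN_equiv pi z x t.
move=> _ /mapP[_ /[!mem_enum] /imsetP[x _ ->] ->].
suff -> : f [set y in [set: 'I_n] | pi x y]%SET = [set j | pi x j].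
  have : blocksN pi [set j | pi x j] by exists (x : nat).
  by rewrite blocksA.
apply/seteqP; split=> [j [i /[!inE]/= xi]|j /= xj].
  by have [_ /(_ xi) ->] := partN_equiv pi x i j.
by exists x => //; rewrite !inE partN_refl.
Qed.

Lemma measurable_restr n (A : set (partI n)) :
  measurable [set pi | A (restr n pi)].
Proof.
have -> : [set pi | A (restr n pi)] =
    \bigcup_(P in A) [set pi | restr n pi = P].
  apply/seteqP; split=> [pi Api|pi [P AP /= ->]//]; by exists (restr n pi).
apply: fin_bigcup_measurable => [|P _]; first exact: finite_finset.
by apply: sub_sigma_algebra; exists n, P.
Qed.

(** * Paintbox laws *)

Section paintbox.
Context (R : realType).
Local Open Scope ereal_scope.
Implicit Types x : Sdown R.

Definition dust x : \bar R := 1 - \sum_(0 <= k <oo) (x k)%:E.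

Lemma mass_sum_ge0 x : 0 <= \sum_(0 <= k <oo) (x k)%:E.
Proof. by apply: nneseries_ge0 => k _ _; rewrite lee_fin mass_ge0. Qed.

Lemma mass_sum_fin x : \sum_(0 <= k <oo) (x k)%:E \is a fin_num.
Proof.
rewrite ge0_fin_numE ?mass_sum_ge0 //.
by apply: le_lt_trans (mass_sum x) _; rewrite ltry.
Qed.

Lemma dust_ge0 x : 0 <= dust x.
Proof. by rewrite sube_ge0 ?mass_sum // mass_sum_fin. Qed.

Lemma mass_le0 x k : (x k <= x 0%N)%R.
Proof. by elim: k => // k; apply: le_trans; exact: mass_noninc. Qed.

(** The law of the i-th label of a paintbox: label k + 1 is the k-th colour and
    label - (i + 1), that is [Negz i], is private to i. *)
Definition label_prob x (i : nat) (c : int) : \bar R :=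
  match c with
  | Posz k.+1 => (x k)%:E
  | Posz 0 => 0
  | Negz j => if j == i then dust x else 0
  end.

Lemma label_prob_ge0 x i c : 0 <= label_prob x i c.
Proof.
case: c => [[|k]|j] //=; first by rewrite lee_fin mass_ge0.
by case: ifP => // _; exact: dust_ge0.
Qed.

(** The prescribed probabilities already add up to 1, so that all other labels
    have probability 0. *)
Lemma prob_label x d (T : measurableType d) (P : probability T R)
    (X : nat -> T -> int) i c :
  (forall A : set int, measurable (X i @^-1` A)) ->
  (forall k, P [set w | X i w = k.+1%:Z] = (x k)%:E) ->
  P [set w | X i w = (- i.+1%:Z)%R] = dust x ->
  P [set w | X i w = c] = label_prob x i c.
Proof.
move=> mX Pmass Pdust.
have mXc c' : measurable [set w | X i w = c'] by exact: (mX [set c']).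
pose S := \bigcup_k [set w | X i w = k.+1%:Z].
have mS : measurable S by exact: bigcup_measurable.
have PS : P S = \sum_(0 <= k <oo) (x k)%:E.
  rewrite measure_semi_bigcup //=.
    by apply: eq_eseriesr => k _; exact: Pmass.
  by move=> j k _ _ [w [/= -> [->]]].
(* The complement of the private label contains S and has the same probability,
   so that what it contains outside S is null. *)
have other : ~ (S `&` [set w | X i w = c] !=set0) -> c <> (- i.+1%:Z)%R ->
    P [set w | X i w = c] = 0.
  move=> Sc ci; apply/eqP; rewrite eq_le measure_ge0 andbT.
  rewrite -(@leeD2lE _ (P S)) ?PS ?mass_sum_fin // adde0 -PS -measureU //; last first.
    by apply/seteqP; split=> // w /= Sw; apply: Sc; exists w.
  have -> : P S = P (~` [set w | X i w = (- i.+1%:Z)%R]).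
    rewrite probability_setC // [P _ in RHS]Pdust PS /dust.
    by rewrite -(fineK (mass_sum_fin x)) -!EFinB opprB addrC subrK.
  apply: le_measure; rewrite ?inE; [exact: measurableU|exact: measurableC|].
  by move=> w [[k _ /= ->]//|/= -> /ci].
case: c other => [[|k]|j] //= other.
- by apply: other => // -[w [[k _ /= ->]]].
- case: (eqVneq j i) => [->|/eqP ji]; first exact: Pdust.
  by apply: other => [[w [[k _ /= ->]]]|[]] //.
Qed.

Definition tuple_prob x s (c : s.-tuple int) : \bar R :=
  \prod_(i < s) label_prob x i (tnth c i).

Lemma tuple_prob_ge0 x s (c : s.-tuple int) : 0 <= tuple_prob x c.
Proof. by apply: prode_ge0 => i _; exact: label_prob_ge0. Qed.

(** The n-th finite sequence of labels, in an enumeration of all of them, is the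
    one observed; integers that code no sequence give the empty event. *)
Definition label_event s (T : Type) (X : nat -> T -> int) (n : nat) : set T :=
  if pickle_inv n is Some c
  then [set w | forall i, (i < s)%N -> X i w = nth 0%R (c : s.-tuple int) i]
  else set0.

Definition label_codes s (A : set (partI s)) : set nat :=
  [set n | exists2 c : s.-tuple int, pickle_inv n = Some c
           & A (restr s (part_of_labels (nth 0%R c)))].

(** A restriction depends on finitely many labels only, hence takes a given
    value on a countable union of events prescribing these labels. *)
Lemma restr_labels s (A : set (partI s)) (T : Type) (X : nat -> T -> int) :
  [set w | A (restr s (part_of_labels (X^~ w)))] =
  \bigcup_(n in label_codes A) label_event s X n.
Proof.
apply/seteqP; split=> [w /= Xw|w [n [c nc Ac]]].
  pose c := [tuple X i w | i < s].
  have cX i : (i < s)%N -> nth 0%R c i = X i w.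
    by move=> i_s; rewrite -(tnth_nth 0%R _ (Ordinal i_s)) tnth_mktuple.
  exists (pickle c); last by rewrite /label_event pickleK_inv => i /cX ->.
  exists c; first exact: pickleK_inv.
  rewrite (_ : restr _ _ = restr s (part_of_labels (X^~ w))) //.
  by apply: eq_restr => i j /=; rewrite !cX.
rewrite /label_event nc => /= Xc.
rewrite (_ : restr _ _ = restr s (part_of_labels (nth 0%R c))) //.
by apply: eq_restr => i j /=; rewrite !Xc.
Qed.

Lemma trivIset_label_event s D (T : Type) (X : nat -> T -> int) :
  trivIset D (label_event s X).
Proof.
move=> n n' _ _ [w []]; rewrite /label_event.
case en: (pickle_inv n) => [c|] //= Xc.
case en': (pickle_inv n') => [c'|] //= Xc'.
have cc' : c = c'.
  by apply: eq_from_tnth => i; rewrite !(tnth_nth 0%R) -Xc // Xc'.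
have := @pickle_invK (s.-tuple int) n; have := @pickle_invK (s.-tuple int) n'.
by rewrite en en' /= cc' => -> ->.
Qed.

Lemma measurable_label_event s d (T : measurableType d) (X : nat -> T -> int) n :
  (forall i (A : set int), measurable (X i @^-1` A)) ->
  measurable (label_event s X n).
Proof.
move=> mX; rewrite /label_event; case: pickle_inv => // c.
have -> : [set w | forall i, (i < s)%N -> X i w = c`_i] =
    \bigcap_(i in [set i | (i < s)%N]) X i @^-1` [set c`_i] by [].
by apply: bigcap_measurableType => i _; exact: mX.
Qed.

(** This formula expresses the law through the masses of x alone; it is the
    reason why it depends measurably on x. *)
Lemma paintbox_restr x (m : probability partN R) s (A : set (partI s)) :
  is_paintbox_law x m ->
  m [set pi | A (restr s pi)] =
  \sum_(0 <= n <oo | n \in label_codes A)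
    if pickle_inv n is Some c then tuple_prob x (c : s.-tuple int) else 0.
Proof.
move=> [d [T [P [X [mX indep Pmass Pdust mE]]]]].
rewrite mE; last exact: measurable_restr.
rewrite [X in P X = _]restr_labels measure_bigcup; last 2 first.
- by move=> n _; exact: measurable_label_event.
- exact: trivIset_label_event.
apply: eq_eseriesr => n _; rewrite /label_event; case: pickle_inv => // c.
have := indep s (fun i => [set c`_i]); rewrite /= => ->.
rewrite /tuple_prob; apply: eq_bigr => i _; rewrite (tnth_nth 0%R).
exact: (prob_label _ (mX _) (Pmass _) (Pdust _)).
Qed.

(** Sum over the common label c: once element 0 has label c, every other
    element has it with probability at most x_0, a private label being
    impossible for two elements. *)
Lemma paintbox_one_block x (m : probability partN R) s :
  is_paintbox_law x m ->
  m [set pi | blocks_of (restr s.+1 pi) = [set [set: 'I_s.+1]]%SET] <=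
  (x 0%N ^+ s)%:E.
Proof.
move=> [d [T [P [X [mX indep Pmass Pdust mE]]]]].
rewrite mE; last first.
  exact: (@measurable_restr _ [set P' | blocks_of P' = [set [set: 'I_s.+1]]%SET]).
pose G n : set T :=
  if pickle_inv n is Some c then X 0%N @^-1` [set c] else set0.
pose F n : set T := if pickle_inv n is Some c then
  [set w | forall i, (i < s.+1)%N -> X i w = c] else set0.
have mG n : measurable (G n) by rewrite /G; case: pickle_inv.
(* The events G partition the space according to the label of 0. *)
have PG : \sum_(0 <= n <oo) P (G n) = 1.
  rewrite -measure_semi_bigcup //; last 2 first.
  - move=> n n' _ _ [w []]; rewrite /G.
    case en: (pickle_inv n) => [c|] //= Xc.
    case en': (pickle_inv n') => [c'|] //= Xc'.
    have := @pickle_invK int n; have := @pickle_invK int n'.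
    by rewrite en en' /= -Xc -Xc' => -> ->.
  - exact: bigcup_measurable.
  rewrite -(probability_setT P); congr (P _).
  apply/seteqP; split=> // w _; exists (pickle (X 0%N w)) => //.
  by rewrite /G pickleK_inv.
have mF n : measurable (F n).
  rewrite /F; case: pickle_inv => // c.
  rewrite (_ : mkset _ =
    \bigcap_(i in [set i | (i < s.+1)%N]) X i @^-1` [set c]) //.
  by apply: bigcap_measurableType => i _; exact: mX.
apply: (@le_trans _ _ (\sum_(0 <= n <oo) P (F n))).
  apply: measure_sigma_subadditive => //.
    rewrite (restr_labels [set P' | blocks_of P' = [set [set: 'I_s.+1]]%SET]).
    by apply: bigcup_measurable => n _; exact: measurable_label_event.
  move=> w /= one; exists (pickle (X 0%N w)) => //.
  rewrite /F pickleK_inv => i i_s.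
  by have /eqP := @restr_one_block _ (part_of_labels (X^~ w)) (Ordinal i_s) ord0 one.
rewrite -[leRHS]mule1 -PG -nneseriesZl; last by move=> n _; exact: measure_ge0.
apply: lee_nneseries => [n _ _|n _]; first exact: measure_ge0.
rewrite /F /G; case: pickle_inv => [c|]; last by rewrite !measure0 mule0.
have := indep s.+1 (fun=> [set c]); rewrite /= => ->.
rewrite big_ord_recl /= [leRHS]muleC.
under eq_bigr do rewrite (prob_label c (mX _) (Pmass _) (Pdust _)).
rewrite [P (X 0%N @^-1` _)](prob_label c (mX _) (Pmass _) (Pdust _)).
have [c0|c0] := eqVneq (label_prob x 0 c) 0; first by rewrite c0 !mul0e.
rewrite lee_wpmul2l ?label_prob_ge0 //.
have le_x0 (i : 'I_s) : label_prob x (bump 0 i) c <= (x 0%N)%:E.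
  case: c c0 => [[|k]|[|j]]; rewrite /= ?eqxx ?lee_fin //.
  - by move=> _; exact: mass_le0.
  - by move=> _; exact: mass_ge0.
have -> : (x 0%N ^+ s)%:E = \prod_(i < s) (x 0%N)%:E.
  by rewrite prodEFin prodr_const card_ord.
suff /andP[] : 0 <= \prod_(i < s) label_prob x (bump 0 i) c <=
    \prod_(i < s) (x 0%N)%:E by [].
elim/big_rec2: _ => [|i y1 y2 _ /andP[y1_ge0 y12]]; first by rewrite lexx lee01.
by rewrite mule_ge0 ?label_prob_ge0 //= lee_pmul ?label_prob_ge0.
Qed.

Lemma measurable_mass k : measurable_fun setT (fun x : Sdown R => x k).
Proof.
move=> _ B mB; rewrite setTI; apply: sub_sigma_algebra.
by exists k => //; exists B => //; rewrite setTI.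
Qed.

Lemma measurable_label_prob i c :
  measurable_fun setT (fun x : Sdown R => label_prob x i c).
Proof.
have mmass k : measurable_fun setT (fun x : Sdown R => (x k)%:E).
  by apply/measurable_EFinP; exact: measurable_mass.
case: c => [[|k]|j] /=; [exact: measurable_cst|exact: mmass|].
case: eqP => // _.
apply: emeasurable_funB; first exact: measurable_cst.
apply: ge0_emeasurable_sum => // k x _ _; by rewrite lee_fin mass_ge0.
Qed.

Lemma measurable_paintbox_restr (mu : Sdown R -> probability partN R) s
    (P' : partI s) :
  (forall x, is_paintbox_law x (mu x)) ->
  measurable_fun setT (fun x => mu x [set pi | restr s pi = P']).
Proof.
move=> mu_law; under eq_fun do rewrite (paintbox_restr [set P'] (mu_law _)).
apply: ge0_emeasurable_sum => [n x _ _|n _].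
  by case: pickle_inv => // c; exact: tuple_prob_ge0.
case: pickle_inv => [c|]; last exact: measurable_cst.
rewrite /tuple_prob; elim: (index_enum _) => [|i r IHr].
  by under eq_fun do rewrite big_nil; exact: measurable_cst.
under eq_fun do rewrite big_cons.
by apply: emeasurable_funM => //; exact: measurable_label_prob.
Qed.

End paintbox.

(** * The rate at which a large block is dislocated *)

Lemma measure_sum_fibers (R : realType) d (T : measurableType d)
    (m : {measure set T -> \bar R}) (S : finType) (f : T -> S) (Q : pred S)
    (E : set T) :
  measurable E -> (forall x, measurable [set w | f w = x]) ->
  m (E `&` [set w | Q (f w)]) = (\sum_(x | Q x) m (E `&` [set w | f w = x]))%E.
Proof.
move=> mE mf; rewrite -big_filter.
set r := [seq x <- index_enum S | Q x].
have -> : [set w | Q (f w)] = [set w | f w \in r].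
  by apply/seteqP; split=> w; rewrite /= mem_filter mem_index_enum andbT.
have : uniq r by rewrite filter_uniq // index_enum_uniq.
elim: r => [_|x r IHr /= /andP[xr r_uniq]].
  rewrite big_nil (_ : _ `&` _ = set0) ?measure0 //.
  by apply/seteqP; split=> // w [].
have mfr : measurable [set w | f w \in r].
  rewrite (_ : mkset _ = \bigcup_(y in [set y | y \in r]) [set w | f w = y]).
    by apply: fin_bigcup_measurable => // ; exact: finite_finset.
  by apply/seteqP; split=> [w wr|w [y yr /= ->]//]; exists (f w).
rewrite big_cons -IHr // -measureU; [|exact: measurableI..|].
  congr (m _); apply/seteqP; split=> [w|w] /=; rewrite inE.
    by move=> [Ew /orP[/eqP|]]; [left|right].
  by move=> [[Ew /eqP ->]|[Ew ->]]; rewrite ?orbT.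
by apply/seteqP; split=> // w [[_ /= ->] [_ /= xr']]; rewrite xr' in xr.
Qed.

Lemma measure_sum_fibersT (R : realType) d (T : measurableType d)
    (m : {measure set T -> \bar R}) (S : finType) (f : T -> S) (E : set T) :
  measurable E -> (forall x, measurable [set w | f w = x]) ->
  m E = (\sum_x m (E `&` [set w | f w = x]))%E.
Proof.
move=> mE mf; rewrite -(measure_sum_fibers m predT mE mf).
by congr (m _); apply/seteqP; split=> [w|w []].
Qed.

Section fragmentation_rate.
Context (R : realType).
Local Open Scope ereal_scope.
Variables (mu : Sdown R -> probability partN R) (ce : R).
Variable nuD : {measure set (Sdown R) -> \bar R}.
Hypothesis mu_law : forall x, is_paintbox_law x (mu x).

Definition nontrivial s (P' : partI s) : bool :=
  blocks_of P' != [set [set: 'I_s]]%SET.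

Lemma nontrivial_epsilon1 s n : (n < s.+2)%N ->
  nontrivial (restr s.+2 (epsilon1 n)).
Proof.
case: n => [|n] ns; apply/eqP => one.
  by have := restr_one_block ord0 (lift ord0 ord0) one.
by have := restr_one_block (Ordinal ns) ord0 one; rewrite /= eqxx.
Qed.

(** Each of the s + 2 partitions that isolate one of the first elements restricts
    to a nontrivial partition. *)
Lemma erosion_ge s : s.+2%:R%:E <=
  \sum_(P' : partI s.+2 | nontrivial P')
    @erosion R [set pi | restr s.+2 pi = P'].
Proof.
apply: (@le_trans _ _ (\sum_(P' : partI s.+2 | nontrivial P')
  \sum_(0 <= n < s.+2) \d_(epsilon1 n) [set pi | restr s.+2 pi = P'])); last first.
  apply: lee_sum => P' _; exact: nneseries_lim_ge.
rewrite exchange_big /= big_mkord.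
apply: (@le_trans _ _ (\sum_(n < s.+2) 1)).
  by rewrite sumEFin sumr_const card_ord.
apply: lee_sum => n _.
rewrite (bigD1 (restr s.+2 (epsilon1 n))) ?nontrivial_epsilon1 //=.
rewrite diracE mem_set // leeDl // sume_ge0 //.
Qed.

Lemma paintbox_nontrivial_ge s (x : Sdown R) :
  1 - (x 0%N ^+ s)%:E <=
  \sum_(P' : partI s.+1 | nontrivial P') mu x [set pi | restr s.+1 pi = P'].
Proof.
have mr (P' : partI s.+1) : measurable [set pi | restr s.+1 pi = P'].
  exact: (@measurable_restr s.+1 [set P']).
have <- : mu x [set pi | nontrivial (restr s.+1 pi)] =
    \sum_(P' : partI s.+1 | nontrivial P') mu x [set pi | restr s.+1 pi = P'].
  rewrite -[X in mu x X]setTI (measure_sum_fibers (mu x) (@nontrivial s.+1)) //.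
  by under eq_bigr do rewrite setTI.
have -> : [set pi | nontrivial (restr s.+1 pi)] =
   ~` [set pi | blocks_of (restr s.+1 pi) = [set [set: 'I_s.+1]]%SET].
  by apply/seteqP; split=> pi /eqP.
rewrite probability_setC; last first.
  exact: (@measurable_restr _ [set P' | blocks_of P' = [set [set: 'I_s.+1]]%SET]).
by rewrite leeB // paintbox_one_block.
Qed.

(** The masses sum to at most 1, so that the largest leaves no room for the
    others. *)
Lemma mass_eq_unit (x : Sdown R) : (1 <= x 0%N)%R ->
  forall i, x i = (i == 0%N)%:R.
Proof.
move=> x0_ge1.
have partial n : (\sum_(0 <= i < n) x i <= 1)%R.
  rewrite -lee_fin -sumEFin; apply: le_trans (mass_sum x).
  by apply: nneseries_lim_ge => k _ _; rewrite lee_fin mass_ge0.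
have x0 : x 0%N = 1%R.
  by apply/eqP; rewrite eq_le x0_ge1 andbT; have := partial 1%N; rewrite big_nat1.
case=> [//|i]; apply/eqP; rewrite eq_le mass_ge0 andbT /=.
have := partial i.+2; rewrite big_nat_recr // big_nat_recl //= x0.
rewrite -addrA gerDl; apply: le_trans; rewrite lerDr.
by apply: sumr_ge0 => k _; exact: mass_ge0.
Qed.

Lemma measurable_mass_le k (c : R) :
  measurable [set x : Sdown R | (x k <= c)%R].
Proof.
rewrite (_ : mkset _ = setT `&` (fun x : Sdown R => x k) @^-1` `]-oo, c]%classic).
  by apply: measurable_mass => //; exact: measurable_itv.
by rewrite setTI; apply/seteqP; split=> x /=; rewrite in_itv.
Qed.

(** These sets increase to the complement of the null set where the largest mass
    is 1. *)
Lemma cvg_disl_mass :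
  nuD [set x | forall i : nat, x i = (i == 0%N)%:R] = 0 ->
  nuD [set: Sdown R] = +oo ->
  nuD [set x : Sdown R | (x 0%N <= 1 - j.+1%:R^-1)%R] @[j --> \oo] --> +oo.
Proof.
move=> nu1 nuT.
pose A j := [set x : Sdown R | (x 0%N <= 1 - j.+1%:R^-1)%R].
have mA j : measurable (A j) by exact: measurable_mass_le.
have mA' : measurable (\bigcup_j A j) by exact: bigcup_measurable.
have nearA (x : Sdown R) : (x 0%N < 1)%R -> (\bigcup_j A j) x.
  rewrite -subr_gt0 => x_lt1.
  have [j _ /(_ j (leqnn _)) /= xj] := near_infty_natSinv_lt (PosNum x_lt1).
  by exists j => //; rewrite /A /= lerBrDr -lerBrDl ltW.
have EA : ~` (\bigcup_j A j) = [set x | forall i : nat, x i = (i == 0%N)%:R].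
  apply/seteqP; split=> [x nAx|x /= x1 [j _]].
    by apply: mass_eq_unit; rewrite leNgt; apply/negP => /nearA.
  by rewrite /A /= x1 lerDl oppr_ge0 leNgt invr_gt0 ltr0Sn.
have nuA : nuD (\bigcup_j A j) = +oo.
  have : nuD setT = nuD (\bigcup_j A j) + nuD (~` (\bigcup_j A j)).
    by rewrite -measureU ?setUv ?setICr //; exact: measurableC.
  by rewrite nuT [X in _ + X](_ : _ = 0) ?adde0 // EA.
rewrite -nuA; apply: nondecreasing_cvg_mu => // i j ij.
apply/subsetPset => x /= /le_trans; apply.
by rewrite lerD2l lerN2 lef_pV2 ?posrE ?ltr0Sn // ler_nat ltnS.
Qed.

(** Take j such that the x with x_0 <= r = 1 - 1 / (j + 1) have measure at least
    2 M, and s so large that r ^ s <= 1/2: the probability of a nontrivial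
    restriction is at least 1/2 on a set of measure at least 2 M. *)
Lemma disl_rate_unbounded (M : R) :
  nuD [set x | forall i : nat, x i = (i == 0%N)%:R] = 0 ->
  nuD [set: Sdown R] = +oo ->
  \forall s \near \oo, M%:E <=
   \sum_(P' : partI s | nontrivial P') \int[nuD]_x mu x [set pi | restr s pi = P'].
Proof.
move=> nu1 /(cvg_disl_mass nu1)/cvgeyPge/(_ (2 * M)%R)[j _ /(_ j (leqnn _))].
set r : R := (1 - j.+1%:R^-1)%R.
pose A : set (Sdown R) := [set x : Sdown R | (x 0%N <= r)%R].
rewrite -[mkset _]/A => nuA.
have mA : measurable A by exact: measurable_mass_le.
have r_ge0 : (0 <= r)%R by rewrite subr_ge0 invf_le1 ?ltr0Sn // ler1n.
have : (`|r| < 1)%R by rewrite ger0_norm // gtrBl invr_gt0 ltr0Sn.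
move=> /cvg_expr/cvgrPdist_lt/(_ 2^-1%R).
rewrite invr_gt0 ltr0n => /(_ isT)[s0 _ small].
exists s0.+1 => // -[//|s] /= s0s.
rewrite -big_filter -ge0_integral_sum //; last first.
  by move=> P'; exact: measurable_paintbox_restr.
have mf : measurable_fun setT (fun x =>
  \sum_(P' <- [seq P' <- index_enum (partI s.+1) | nontrivial P'])
     mu x [set pi | restr s.+1 pi = P']).
  by apply: emeasurable_sum => P'; exact: measurable_paintbox_restr.
apply: (@le_trans _ _ (\int[nuD]_(x in A) (2^-1)%:E)).
  rewrite integral_cst //.
  have -> : M%:E = (2^-1)%:E * (2 * M)%:E.
    by rewrite -EFinM mulrA mulVf ?mul1r // pnatr_eq0.
  by rewrite lee_wpmul2l // lee_fin invr_ge0.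
apply: (@le_trans _ _ (\int[nuD]_(x in A)
  \sum_(P' <- [seq P' <- index_enum (partI s.+1) | nontrivial P'])
     mu x [set pi | restr s.+1 pi = P'])); last first.
  apply: ge0_subset_integral => // x _; exact: sume_ge0.
apply: ge0_le_integral => //.
  exact: measurable_funS mf.
move=> x Ax; rewrite big_filter.
apply: le_trans (paintbox_nontrivial_ge s x).
rewrite -EFinB lee_fin lerBrDr -lerBrDl.
have -> : (1 - 2^-1 = 2^-1 :> R)%R by rewrite [X in (X - _)%R]splitr mul1r addrK.
apply: (@le_trans _ _ (r ^+ s)%R).
  by rewrite lerXn2r ?nnegrE ?mass_ge0.
have := small s s0s; rewrite sub0r normrN ger0_norm ?exprn_ge0 //; exact: ltW.
Qed.

Lemma frag_rate_unbounded (ck : R) (nuC : {measure set (Sdown R) -> \bar R}) (M : R) :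
  is_characteristics ck nuC ce nuD ->
  fragmentates_quickly ce nuD ->
  \forall s \near \oo, M%:E <=
   \sum_(P' : partI s | nontrivial P')
      frag_measure mu ce nuD [set pi | restr s pi = P'].
Proof.
move=> [[_ ce_ge0] _ _ nu1 _] [ce_gt0|nuT].
  have [n _ nM] := nbhs_infty_ger (M / ce).
  exists n.+2 => // -[//|[//|s]] /= ns.
  apply: (@le_trans _ _ (ce%:E * s.+2%:R%:E)).
    rewrite -EFinM lee_fin mulrC -ler_pdivrMr //; apply: nM => /=.
    by do 2 rewrite -ltnS; apply: leq_trans ns _; rewrite leqW.
  apply: le_trans (lee_wpmul2l _ (erosion_ge s)) _; first by rewrite lee_fin.
  rewrite ge0_sume_distrr; last first.
    by move=> P' _; rewrite /erosion; exact: nneseries_ge0.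
  apply: lee_sum => P' _; rewrite /frag_measure leeDl //.
  by apply: integral_ge0.
have ge0 s (P' : partI s) : 0 <= ce%:E * @erosion R [set pi | restr s pi = P'].
  by rewrite mule_ge0 // ?lee_fin // /erosion; exact: nneseries_ge0.
apply: filterS (disl_rate_unbounded M nu1 nuT) => s /le_trans; apply.
by apply: lee_sum => P' _; rewrite /frag_measure leeDr.
Qed.
End fragmentation_rate.

(** * Exit of a finite Markov chain from a set with a strong drift *)

Lemma near_forall_fin (T : Type) (F : set_system T) (S : finType)
    (Q : S -> T -> Prop) :
  Filter F -> (forall x, F (Q x)) -> \forall t \near F, forall x, Q x t.
Proof.
move=> FF FQ.
suff FQr (r : seq S) : \forall t \near F, forall x, x \in r -> Q x t.
  by apply: filterS (FQr (enum S)) => t Qt x; apply: Qt; rewrite mem_enum.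
elim: r => [|x r IHr]; first by near=> t.
apply: filterS2 (FQ x) IHr => t Qx Qr y; rewrite inE => /predU1P[->//|]; exact: Qr.
Unshelve. all: by end_near. Qed.

Lemma bernoulli_ineq (R : realDomainType) (x : R) n :
  0 <= x -> 1 + x *+ n <= (1 + x) ^+ n.
Proof.
move=> x0; elim: n => [|n IHn]; first by rewrite mulr0n addr0 expr0.
rewrite exprSr; apply: (@le_trans _ _ ((1 + x *+ n) * (1 + x))); last first.
  by rewrite ler_wpM2r // addr_ge0.
rewrite mulrSr mulrDr mulr1 mulrDl mul1r -addrA lerD2l addrA lerDl.
by rewrite mulr_ge0 ?mulrn_wge0.
Qed.

(** The function g is a Lyapunov function for the exit from A: on A, the
    generator makes it decrease at relative speed more than theta. *)
Section drift.
Context (R : realType) (d : measure_display) (T : measurableType d).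
Context (P : probability T R) (S : finType) (X : R -> T -> S) (q : S -> S -> R).
Hypothesis chain : markov_chain P X q.
Hypothesis mX : forall t x, 0 <= t -> measurable [set w | X t w = x].
Variables (A : pred S) (g : S -> R) (K theta : R).
Hypothesis g_ge0 : forall x, 0 <= g x.
Hypothesis g_ge1 : forall x, A x -> 1 <= g x.
Hypothesis g_leK : forall x, g x <= K.
Hypothesis theta_gt0 : 0 < theta.
Hypothesis g_drift : forall x, A x ->
  \sum_(y | y != x) q x y * (g y - g x) < - (theta * g x).

Definition stays_on_grid (a h : R) n : set T :=
  [set w | forall j, (j <= n)%N -> A (X (a + h *+ j) w)].

Lemma measurable_stays_on_grid a h n : 0 <= a -> 0 <= h ->
  measurable (stays_on_grid a h n).
Proof.
move=> a0 h0; rewrite (_ : stays_on_grid a h n =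
    \bigcap_(j in [set j | (j <= n)%N])
      \bigcup_(x in [set x | A x]) [set w | X (a + h *+ j) w = x]).
  apply: bigcap_measurableType => j _; apply: fin_bigcup_measurable => [|x _].
    exact: finite_finset.
  by apply: mX; rewrite addr_ge0 // mulrn_wge0.
apply/seteqP; split=> w Ew j ji.
  by exists (X (a + h *+ j) w) => //; exact: Ew.
by have [x Ax /= ->] := Ew j ji.
Qed.

(** The sum u over x of P(the chain was in A so far and is now at x) g(x) loses
    at each step the factor 1 - theta h, by the Markov property; it starts below
    K, and dominates the probability of still being in A because g >= 1 there. *)
Lemma prob_grid_le (p : R -> S -> S -> R) (a h : R) n :
  0 <= a -> 0 < h ->
  (forall s t x y B, 0 <= s <= t -> past X setT s B ->
    P (B `&` [set w | X s w = x] `&` [set w | X t w = y]) =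
      (P (B `&` [set w | X s w = x]) * (p (t - s) x y)%:E)%E) ->
  (forall x, A x -> \sum_y p h x y * g y <= (1 - theta * h) * g x) ->
  (forall x y, 0 <= p h x y) ->
  theta * h <= 1 ->
  (P (stays_on_grid a h n) <= ((1 - theta * h) ^+ n * K)%:E)%E.
Proof.
move=> a0 h0 pX pg p_ge0 th1; have x0 := X 0 (point : T).
pose t j := a + h *+ j.
have t_ge0 j : 0 <= t j by rewrite addr_ge0 // mulrn_wge0 // ltW.
pose E i := stays_on_grid a h i.
have mE i : measurable (E i) by apply: measurable_stays_on_grid => //; exact: ltW.
have pastE i : past X setT (t i) (E i).
  rewrite /past; set G := (G in <<s G>>).
  suff : @measurable _ (g_sigma_algebraType G) (E i) by [].
  rewrite (_ : E i = \bigcap_(j in [set j | (j <= i)%N]) [set w | A (X (t j) w)]) //.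
  apply: bigcap_measurableType => j /= ji; apply: sub_sigma_algebra.
  exists (t j); first by rewrite /= t_ge0 lerD2l ler_wpMn2l // ltW.
  by exists [set x | A x] => //; rewrite setTI.
have ES i y : E i.+1 `&` [set w | X (t i.+1) w = y] `<=`
    E i `&` [set w | X (t i.+1) w = y].
  by move=> w [Ew ?]; split=> // j ji; apply: Ew; exact: leqW.
pose pr i x := fine (P (E i `&` [set w | X (t i) w = x])).
have mEX i j x : measurable (E i `&` [set w | X (t j) w = x]).
  by apply: measurableI => //; exact: mX.
have prE i x : (pr i x)%:E = P (E i `&` [set w | X (t i) w = x]).
  by rewrite fineK // fin_num_measure.
have pr_ge0 i x : 0 <= pr i x by rewrite fine_ge0.
have pr0 i x : ~~ A x -> pr i x = 0.
  move=> nAx; rewrite /pr (_ : _ `&` _ = set0) ?measure0 //.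
  by apply/seteqP; split=> // w [/(_ i (leqnn _)) + /= Xx]; rewrite Xx (negbTE nAx).
have prS i y : pr i.+1 y <= \sum_x pr i x * p h x y.
  rewrite -lee_fin prE -sumEFin.
  apply: (@le_trans _ _ (P (E i `&` [set w | X (t i.+1) w = y]))).
    by apply: le_measure; rewrite ?inE //; exact: ES.
  have -> : P (E i `&` [set w | X (t i.+1) w = y]) = (\sum_x
      P (E i `&` [set w | X (t i) w = x] `&` [set w | X (t i.+1) w = y]))%E.
    under eq_bigr do rewrite setIAC.
    by apply: measure_sum_fibersT => // x; exact: mX.
  apply: lee_sum => x _; rewrite pX //; last by rewrite t_ge0 lerD2l mulrSr lerDl ltW.
  rewrite -prE -EFinM (_ : t i.+1 - t i = h) //.
  by rewrite /t mulrSr addrA [X in X - _]addrC addrK.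
pose u i := \sum_x pr i x * g x.
have uS i : u i.+1 <= (1 - theta * h) * u i.
  apply: (@le_trans _ _ (\sum_y \sum_x pr i x * p h x y * g y)).
    by apply: ler_sum => y _; rewrite -mulr_suml ler_wpM2r.
  rewrite exchange_big mulr_sumr; apply: ler_sum => x _ /=.
  have [Ax|/pr0 ->] := boolP (A x); last first.
    by rewrite mul0r mulr0 big1 // => y _; rewrite !mul0r.
  under eq_bigr do rewrite -mulrA.
  by rewrite -mulr_sumr mulrCA ler_wpM2l ?pg.
have PE i : P (E i) = (\sum_x pr i x)%:E.
  rewrite -sumEFin; under eq_bigr do rewrite prE.
  by apply: measure_sum_fibersT => // x; exact: mX.
have u_le i : u i <= (1 - theta * h) ^+ i * K.
  elim: i => [|i IHi].
    rewrite expr0 mul1r; apply: (@le_trans _ _ (\sum_x pr 0%N x * K)).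
      by apply: ler_sum => x _; rewrite ler_wpM2l.
    rewrite -mulr_suml ler_piMl // ?(le_trans _ (g_leK x0)) //.
    by rewrite -lee_fin -PE probability_le1.
  apply: le_trans (uS i) _.
  by rewrite exprS -mulrA ler_wpM2l // subr_ge0.
rewrite [leLHS]PE lee_fin; apply: le_trans (u_le n).
apply: ler_sum => x _; have [/g_ge1 gx|/pr0 ->] := boolP (A x).
  by rewrite ler_peMr.
by rewrite mul0r.
Qed.

(** The event of staying in A throughout [a, b] is an uncountable intersection;
    the measurable set E contains it and prescribes the chain on a grid. *)
Lemma prob_stay_le a b : 0 <= a -> a < b ->
  exists E, [/\ measurable E,
    [set w | forall t, a <= t <= b -> A (X t w)] `<=` E
    & (P E <= (K / (1 + theta * (b - a)))%:E)%E].
Proof.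
move=> a0 ab; have [p [p_dist _ _ p_rate pX]] := chain.
have K_ge0 : 0 <= K by apply: le_trans (g_leK (X 0 (point : T))).
(* The drift condition is about the limit of p h x y / h; being strict, it holds
   for small h, and for all states at once. *)
have drift_near : \forall h \near 0^'+, forall x, A x ->
    \sum_(y | y != x) p h x y / h * (g y - g x) < - (theta * g x).
  apply: near_forall_fin => x; have [Ax|nAx] := boolP (A x); last by apply: nearW.
  suff : \forall h \near 0^'+,
      \sum_(y | y != x) p h x y / h * (g y - g x) < - (theta * g x).
    by apply: filterS.
  apply: cvgr_lt (g_drift Ax); apply: cvg_big; first exact: add_continuous.
  move=> y yx; apply: cvgMl; apply: p_rate; by rewrite eq_sym.
have [e /= e0 small] : \forall h \near 0^'+, h < theta^-1 /\ forall x, A x ->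
    \sum_(y | y != x) p h x y / h * (g y - g x) < - (theta * g x).
  by apply: filterI => //; apply: nbhs_right_lt; rewrite invr_gt0.
have ba_gt0 : 0 < b - a by rewrite subr_gt0.
have [n _ /(_ n (leqnn _)) /= ne] :=
  near_infty_natSinv_lt (PosNum (divr_gt0 e0 ba_gt0)).
pose h := (b - a) / n.+1%:R.
have h_gt0 : 0 < h by rewrite divr_gt0 ?subr_gt0 ?ltr0Sn.
have hn : h *+ n.+1 = b - a by rewrite -mulr_natr divfK // pnatr_eq0.
have [] := small h _ h_gt0.
  by rewrite /ball /= sub0r normrN gtr0_norm // /h mulrC -ltr_pdivlMr.
move=> h_theta h_drift; have h_ge0 := ltW h_gt0.
have th1 : theta * h <= 1 by rewrite -ler_pdivlMl // mulr1 ltW.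
have th0 : 0 <= theta * h by rewrite mulr_ge0 // ltW.
exists (stays_on_grid a h n.+1); split.
- exact: measurable_stays_on_grid.
- move=> w stay j jn; apply: stay; rewrite lerDl mulrn_wge0 //=.
  by rewrite -lerBrDl -hn ler_wpMn2l.
- apply: (@le_trans _ _ ((1 - theta * h) ^+ n.+1 * K)%:E).
    apply: (@prob_grid_le p a h n.+1 a0 h_gt0 pX _ _ th1); last first.
      by move=> x y; have [p_ge0 _] := p_dist h x h_ge0.
    move=> x Ax; have [p_ge0 p_sum1] := p_dist h x h_ge0.
    rewrite (bigD1 x) //=.
    have p_xx : p h x x = 1 - \sum_(y | y != x) p h x y.
      by rewrite -p_sum1 [in RHS](bigD1 x) //= addrK.
    have -> : p h x x * g x + \sum_(y | y != x) p h x y * g y =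
        g x + h * \sum_(y | y != x) p h x y / h * (g y - g x).
      rewrite p_xx mulrBl mul1r -addrA; congr (_ + _).
      rewrite addrC mulr_suml mulr_sumr -sumrB; apply: eq_bigr => y _.
      by rewrite mulrA [h * _]mulrC divfK ?gt_eqF // mulrBr.
    rewrite mulrBl mul1r lerD2l.
    have -> : theta * h * g x = h * (theta * g x) by rewrite -mulrA mulrCA.
    by rewrite -mulrN ler_wpM2l // ltW // h_drift.
  rewrite lee_fin mulrC ler_wpM2l // -[leRHS]mul1r ler_pdivlMr; last first.
    by rewrite ltr_pwDl // mulr_ge0 ?ltW.
  have -> : theta * (b - a) = (theta * h) *+ n.+1 by rewrite -hn [LHS]mulrnAr.
  (* (1 - u)^N (1 + N u) <= ((1 - u) (1 + u))^N <= 1, with u = theta h *)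
  apply: (@le_trans _ _ ((1 - theta * h) ^+ n.+1 * (1 + theta * h) ^+ n.+1)).
    by rewrite ler_wpM2l ?exprn_ge0 ?subr_ge0 ?bernoulli_ineq.
  rewrite -exprMn -subr_sqr expr1n exprn_ile1 ?gerBl ?sqr_ge0 //.
  by rewrite subr_ge0 expr_le1.
Qed.

End drift.

(** * Density of the times with infinitely many blocks *)

Section baire.
Context (R : realType) (f : R -> partN).
Hypothesis f_cadlag : forall n, cadlag (fun t => restr n (f t)).
Hypothesis f_unbounded : forall a b k, 0 <= a -> a < b ->
  exists2 t, a <= t <= b & exists n, (k < #|restr n (f t)|)%N.

(** Right-continuity makes an inequality k < number of blocks at one time hold on
    an interval, which puts an open dense set inside each set [many k]. *)
Lemma infinite_times_dense :
  [set t : R | 0 <= t] `<=` closure (infinite_times f).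
Proof.
have half_lt (z : R) : 0 < z -> z / 2 < z.
  by move=> z_gt0; rewrite ltr_pdivrMr // ltr_pMr // ltr1n.
pose many k := [set t : R | exists n, (k < #|restr n (f t)|)%N].
(* Negative times are added to make the sets dense in the whole line. *)
pose U k : set R^o := [set t : R | t < 0] `|` interior (many k).
have U_dense k : dense (U k).
  move=> O [x Ox] oO; have [x_lt0|x_ge0] := ltP x 0.
    by exists x; split=> //; left.
  have /nbhs_ballP[e /= e_gt0 xeO] : nbhs x O by exact: open_nbhs_nbhs.
  have e2_gt0 : 0 < e / 2 by rewrite divr_gt0.
  have [||t /andP[xt te] [n kn]] := @f_unbounded (x + e / 2 / 2) (x + e / 2) k.
  - by rewrite addr_ge0 // ltW // divr_gt0.
  - by rewrite ltrD2l half_lt.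
  have x_lt_t : x < t by apply: lt_le_trans xt; rewrite ltrDl divr_gt0.
  have [+ _] := f_cadlag n; move=> /(_ t) [|r /= r_gt0 tr].
    by rewrite (le_trans x_ge0) // ltW.
  have t_lt_c : t < Num.min (t + r) (x + e).
    by rewrite lt_min ltrDl r_gt0 (le_lt_trans te) // ltrD2l half_lt.
  have [s] : exists s, s \in `]t, (Num.min (t + r) (x + e))[.
    by exists ((t + Num.min (t + r) (x + e)) / 2); rewrite in_itv /= !midf_lt.
  rewrite in_itv /= lt_min => /and3P[ts sr se]; exists s; split.
    apply: xeO; rewrite /ball /= distrC gtr0_norm ?ltrBlDl //.
    by rewrite subr_gt0 (lt_trans x_lt_t).
  right; apply: (@filterS _ _ _ `]t, t + r[%classic) => [s' /=|].
    rewrite in_itv /= => /andP[ts' s'r]; exists n; rewrite (tr s') //.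
    by rewrite /ball /= distrC gtr0_norm ?subr_gt0 // ltrBlDl.
  by apply: near_in_itvoo; rewrite in_itv /= ts.
have /= U_meet := @Baire R R^o U _.
have {}U_meet : dense (\bigcap_k U k).
  apply: U_meet => k; split => //; apply: openU; last exact: open_interior.
  exact: open_lt.
move=> t /= t_ge0 V /nbhs_ballP[e /= e_gt0 teV].
have [||s [/= s_in Us]] := U_meet `]t, t + e[%classic.
- by exists (t + e / 2); rewrite /= in_itv /= ltrDl ltrD2l divr_gt0 // half_lt.
- exact: itv_open.
move: s_in; rewrite in_itv /= => /andP[ts se].
have s_ge0 : 0 <= s by rewrite (le_trans t_ge0) // ltW.
exists s; split; last first.
  apply: teV; rewrite /ball /= distrC ger0_norm ?subr_ge0 ?ltW //.
  by rewrite ltrBlDl.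
split=> //; apply: infinite_blocksN => k.
by have [/=|/interior_subset] := Us k I; first by rewrite ltNge s_ge0.
Qed.

End baire.

(** * The number of blocks of an EFC process *)

Section rates.
Context (R : realType) (d : measure_display) (T : measurableType d).
Context (P : probability T R) (Pi : R -> T -> partN).
Context (q : forall n : nat, partI n -> partI n -> R).
Context (ck ce : R) (nuC nuD : {measure set (Sdown R) -> \bar R}).
Hypothesis chars : is_characteristics ck nuC ce nuD.
Hypothesis efc : EFC_process P Pi q.
Variable mu : Sdown R -> probability partN R.
Hypothesis mu_law : forall x, is_paintbox_law x (mu x).
Hypothesis coag_rates : forall n (x : partI n) (P' : partI #|x|),
  blocks_of P' <> [set [set i] | i : 'I_#|x|]%SET ->
  (q x (coag P'))%:E = coag_measure mu ck nuC [set pi | restr #|x| pi = P'].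
Hypothesis frag_rates : forall n (x : partI n) (k : 'I_#|x|)
    (P' : partI #|block x k|),
  blocks_of P' <> [set [set: 'I_#|block x k|]]%SET ->
  (q x (frag P'))%:E =
  frag_measure mu ce nuD [set pi | restr #|block x k| pi = P'].

Lemma rate_ge0 n (x y : partI n) : x != y -> 0 <= q x y.
Proof.
have [p [p_dist _ _ p_rate _]] := EFC_restr efc n.
move=> /p_rate/cvgr_to_ge; apply; near=> h.
have h_gt0 : 0 < h by near: h; exact: nbhs_right_gt.
have [p_ge0 _] := p_dist h x (ltW h_gt0).
by rewrite divr_ge0 // ltW.
Unshelve. all: by end_near. Qed.

(** The total coalescence rate of m blocks.  No mass is lost in [fine], since the
    real-valued rates of the chain make every summand finite. *)
Definition coag_rate m : R :=
  \sum_(P' : partI m | blocks_of P' != [set [set i] | i : 'I_m]%SET)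
    fine (coag_measure mu ck nuC [set pi | restr m pi = P']).

Lemma coag_measure_ge0 A : (0 <= coag_measure mu ck nuC A)%E.
Proof.
have [[ck0 _] _ _ _ _] := chars.
apply: adde_ge0; last by apply: integral_ge0.
rewrite mule_ge0 // /kappa; exact: esum_ge0.
Qed.

Lemma coag_rate_ge0 m : 0 <= coag_rate m.
Proof. by apply: sumr_ge0 => P' _; rewrite fine_ge0 ?coag_measure_ge0. Qed.

(** Fragmentations never lower the number of blocks, so every such y is obtained
    by a nontrivial coalescence of the blocks of x. *)
Lemma down_rate_le n (x : partI n) :
  \sum_(y : partI n | (#|y| < #|x|)%N) q x y <= coag_rate #|x|.
Proof.
have qE (P' : partI #|x|) : blocks_of P' != [set [set i] | i : 'I_#|x|]%SET ->
    q x (coag P') = fine (coag_measure mu ck nuC [set pi | restr #|x| pi = P']).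
  by move=> /eqP/coag_rates <-.
rewrite /coag_rate -(eq_bigr _ qE) (partition_big (fun P' => coag P') predT) //=.
rewrite big_mkcond /=; apply: ler_sum => y _.
have sum_ge0 : 0 <= \sum_(P' : partI #|x| |
    (blocks_of P' != [set [set i] | i : 'I_#|x|]%SET) && (coag P' == y)) q x (coag P').
  by apply: sumr_ge0 => P' /andP[/qE -> _]; rewrite fine_ge0 ?coag_measure_ge0.
case: ifP => // yx; have [-> //|/eqP q0] := eqVneq (q x y) 0.
have y_neq : y <> x by move=> e; rewrite e ltnn in yx.
have [[P' yE]|[k [P' yE]]] := EFC_moves efc y_neq q0.
  rewrite (bigD1 P') /=; last first.
    rewrite yE eqxx andbT; apply/eqP => P'1; apply: y_neq.
    by rewrite yE coag_singletons.
  rewrite -yE lerDl; apply: sumr_ge0 => Q /andP[/andP[/qE -> _] _].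
  by rewrite fine_ge0 ?coag_measure_ge0.
by rewrite ltnNge yE leq_card_frag in yx.
Qed.

(** Distinct nontrivial dislocations of one block lead to distinct partitions,
    all with more blocks than x. *)
Lemma up_rate_ge n (x : partI n) (k : 'I_#|x|) :
  ((\sum_(P' : partI #|block x k| | nontrivial P')
    frag_measure mu ce nuD [set pi | restr #|block x k| pi = P']) <=
  (\sum_(y : partI n | (#|x| < #|y|)%N) q x y)%:E)%E.
Proof.
rewrite (eq_bigr (fun P' => (q x (frag P'))%:E)); last first.
  by move=> P' /eqP P'1; rewrite frag_rates.
rewrite sumEFin lee_fin.
rewrite -[leLHS](@big_imset _ _ _ _ _ (@frag n x k) [pred P' | nontrivial P']
  (fun y => q x y)) => [|P1 P2 _ _ /frag_inj //].
rewrite big_mkcond [leRHS]big_mkcond /=; apply: ler_sum => y _.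
case: ifP => [/imsetP[P' /eqP P'1 ->]|_]; first by rewrite ltn_card_frag.
case: ifP => // xy; apply: rate_ge0.
by apply: contraTneq xy => ->; rewrite ltnn.
Qed.

(** A jump downwards raises the function by at most k, a jump upwards lowers it
    by at least 1; large n makes the upward rate exceed any constant M, here
    chosen to beat both the downward rates and the term theta (k + 1). *)
Lemma block_count_drift k (theta : R) : 0 < theta ->
  fragmentates_quickly ce nuD ->
  exists n, forall x : partI n, (#|x| <= k)%N ->
    \sum_(y | y != x) q x y * ((k.+1 - #|y|)%N%:R - (k.+1 - #|x|)%N%:R) <
    - (theta * (k.+1 - #|x|)%N%:R).
Proof.
move=> theta_gt0 quick.
pose Lam := \sum_(m < k.+1) coag_rate m.
pose M := k%:R * Lam + theta * k.+1%:R + 1.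
have [s0 _ big_rate] := frag_rate_unbounded mu_law M chars quick.
exists (s0 * k).+1 => x xk.
have [i /ltnW/big_rate] := @large_block _ s0 x
  (leq_ltn_trans (leq_mul (leqnn s0) xk) (ltnSn _)).
move=> /le_trans/(_ (up_rate_ge i)); rewrite lee_fin => up.
have Lam_ge : coag_rate #|x| <= Lam.
  rewrite /Lam (bigD1 (inord #|x|)) //= inordK // lerDl.
  by apply: sumr_ge0 => j _; exact: coag_rate_ge0.
have down := down_rate_le x.
apply: (@le_lt_trans _ _ (k%:R * (\sum_(y : partI _ | (#|y| < #|x|)%N) q x y) -
   \sum_(y : partI _ | (#|x| < #|y|)%N) q x y)).
  rewrite mulr_sumr !(big_mkcond (fun y : partI _ => _ < _)%N) -sumrB.
  rewrite big_mkcond; apply: ler_sum => y _.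
  have [->|yx] /= := eqVneq y x; first by rewrite ltnn subrr.
  have qxy : 0 <= q x y by apply: rate_ge0; rewrite eq_sym.
  case: (ltngtP #|y| #|x|) => [lt_yx|lt_xy|->].
  - rewrite subr0 mulrC ler_wpM2r // lerBlDr -natrD ler_nat.
    apply: leq_trans (leq_subr _ _) _.
    by rewrite -addn1 leq_add2l subn_gt0 addn1 ltnS.
  - rewrite sub0r -[X in _ <= X]mulrN1 ler_wpM2l // lerBlDr addrC lerBrDr natr1 ler_nat.
    by rewrite ltn_sub2l.
  - by rewrite !subrr mulr0.
rewrite ltrBlDr addrC -ltrBlDr opprK; apply: lt_le_trans up.
apply: (@le_lt_trans _ _ (k%:R * Lam + theta * k.+1%:R)); last by rewrite ltrDl.
apply: lerD; first by rewrite ler_wpM2l // (le_trans down).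
by rewrite ler_wpM2l ?(ltW theta_gt0) // ler_nat leq_subr.
Qed.

(** For every theta = j + 1, a suitable restriction provides a measurable cover
    of probability at most (k + 1) / (1 + theta (b - a)). *)
Lemma few_blocks_negligible k a b : fragmentates_quickly ce nuD ->
  0 <= a -> a < b ->
  P.-negligible [set w | forall t, a <= t <= b ->
                   forall n, (#|restr n (Pi t w)| <= k)%N].
Proof.
move=> quick a0 ab; have ba_gt0 : 0 < b - a by rewrite subr_gt0.
have cover (j : nat) : exists E, [/\ measurable E,
    [set w | forall t, a <= t <= b -> forall n, (#|restr n (Pi t w)| <= k)%N]
      `<=` E & (P E <= (k.+1%:R / (1 + j.+1%:R * (b - a)))%:E)%E].
  have [n drift] := block_count_drift k (ltr0Sn R j) quick.
  have mX t (x : partI n) : 0 <= t -> measurable [set w | restr n (Pi t w) = x].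
    move=> t0; rewrite -[mkset _]setTI.
    apply: (EFC_measurable efc t0 measurableT (Y := [set pi | restr n pi = x])).
    exact: (@measurable_restr n [set x]).
  have [|||||E [mE subE PE]] := @prob_stay_le _ _ _ P _ _ _ (EFC_restr efc n) mX
    (fun x => (#|x| <= k)%N) (fun x => (k.+1 - #|x|)%N%:R) k.+1%:R j.+1%:R
    _ _ _ _ _ a b a0 ab.
  - by [].
  - by move=> x xk; rewrite ler1n subn_gt0.
  - by move=> x; rewrite ler_nat leq_subr.
  - by [].
  - exact: drift.
  by exists E; split=> // w few; apply: subE => t /few.
have {cover} [E cover] := choice cover.
exists (\bigcap_j E j); split.
- by apply: bigcap_measurableType => j _; have [] := cover j.
- apply/eqP; rewrite eq_le measure_ge0 andbT; apply/lee_addgt0Pr => e e_gt0.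
  rewrite add0e.
  have c_gt0 : 0 < e * (b - a) / k.+1%:R by rewrite divr_gt0 ?mulr_gt0.
  have [j _ /(_ j (leqnn _)) /= je] := near_infty_natSinv_lt (PosNum c_gt0).
  have [mEj _ PEj] := cover j.
  apply: (@le_trans _ _ (P (E j))).
    apply: le_measure; rewrite ?inE //; last by move=> w; apply.
    by apply: bigcap_measurableType => i _; have [] := cover i.
  apply: le_trans PEj _; rewrite lee_fin.
  rewrite ler_pdivrMr; last by rewrite ltr_pwDl // mulr_ge0 ?ltW.
  move: je; rewrite ltr_pdivlMr // mulrC ltr_pdivrMr // => /ltW /le_trans; apply.
  by rewrite -mulrA ler_wpM2l ?(ltW e_gt0) // [leLHS]mulrC lerDr.
- by move=> w few j _; have [_ sub _] := cover j; apply: sub.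
Qed.

End rates.

Theorem theorem12 (R : realType) (d : measure_display) (T : measurableType d)
    (P : probability T R) (Pi : R -> T -> partN)
    (q : forall n : nat, partI n -> partI n -> R)
    (ck ce : R) (nuC nuD : {measure set (Sdown R) -> \bar R}) :
  is_characteristics ck nuC ce nuD ->
  EFC_process P Pi q ->
  has_characteristics q ck nuC ce nuD ->
  fragmentates_quickly ce nuD ->
  {ae P, forall w : T,
    [set t : R | 0 <= t] `<=` closure (infinite_times (fun t => Pi t w))}.
Proof.
move=> chars efc [mu [mu_law mu_rates]] quick.
have coag_rates n (x : partI n) := let: And3 coagE _ _ := mu_rates n x in coagE.
have frag_rates n (x : partI n) := let: And3 _ fragE _ := mu_rates n x in fragE.
have many m : {ae P, forall w,
    if @unpickle (rat * rat * nat)%type m is Some (u, v, k) then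
    0 <= ratr u :> R -> ratr u < ratr v :> R ->
    exists2 t : R, ratr u <= t <= ratr v & exists n, (k < #|restr n (Pi t w)|)%N
    else True}.
  case: unpickle => [[[u v] k]|]; last by apply: aeW.
  have [u0|nu0] := boolP (0 <= ratr u :> R); last by apply: aeW.
  have [uv|nuv] := boolP (ratr u < ratr v :> R); last by apply: aeW.
  have := few_blocks_negligible chars efc mu_law coag_rates frag_rates k quick u0 uv.
  apply: negligibleS => w /= few t tuv n; rewrite leqNgt; apply/negP => kn.
  by apply: few => _ _; exists t => //; exists n.
apply: filterS2 (ae_foralln (EFC_cadlag efc)) (ae_foralln many) => w cad many_w.
apply: infinite_times_dense => // a b k a0 ab.
have [u] := rat_in_itvoo ab; rewrite in_itv /= => /andP[au ub].
have [v] := rat_in_itvoo ub; rewrite in_itv /= => /andP[uv vb].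
have := many_w (pickle (u, v, k)); rewrite pickleK.
move=> /(_ (le_trans a0 (ltW au)) uv)[t /andP[ut tv] tn]; exists t => //.
by rewrite (le_trans (ltW au)) // (le_trans tv) // ltW.
Qed.
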